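(* In the observable space $\mathbb{R}^p$, the timelag $\tau$ and the eigenvalues $\lambda_1,\dots,\lambda_d$ fully determine the tangent space of the delay-embedded manifold and the linear part of the delay-embedded dynamics at the fixed point; in particular, the linear dynamics are independent of both the full eigenvectors and the observable function. Precisely: let $p,d\in\mathbb{N}^+$, $\tau>0$ and pairwise distinct $\lambda_1,\dots,\lambda_d\in\mathbb{C}$ be given, and consider any two configurations $(n^{(i)},A^{(i)},g^{(i)},\mathcal{M}^{(i)},\mu^{(i)})$, $i=1,2$, as specified in the context, with the same $p$, $d$, $\tau$ and $\lambda_1,\dots,\lambda_d$, with each $\mu^{(i)}$ generic. Let $S^{(i)}$ be the corresponding sampling maps, $\tilde{\mathcal{M}}^{(i)}=S^{(i)}(\mathcal{M}^{(i)})$, $y_0^{(i)}=S^{(i)}(0)$, and $\tilde f^{(i)}$ the induced vector field on $\tilde{\mathcal{M}}^{(i)}$. Then, as linear subspaces, $T_{y_0^{(1)}}\tilde{\mathcal{M}}^{(1)}=T_{y_0^{(2)}}\tilde{\mathcal{M}}^{(2)}$, and, as linear maps on this common subspace, $D\tilde f^{(1)}(y_0^{(1)})=D\tilde f^{(2)}(y_0^{(2)})$.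
   Context: A configuration $(n,A,g,\mathcal{M},\mu)$ (for given $p,d,\tau,\lambda_1,\dots,\lambda_d$) consists of the following. System: $\dot x = Ax+g(x)$, $x\in\mathbb{R}^n$, of class $\mathcal{C}^l$ with $l\in\mathbb{N}^+\cup\{\infty,a\}$ ($a$ = analytic), $g:\mathbb{R}^n\to\mathbb{R}^n$, $g(x)=\mathcal{O}(|x|^2)$, and $A\in\mathbb{R}^{n\times n}$ diagonalizable (over $\mathbb{C}$) with eigenvectors $e_1,\dots,e_n$, the first $d$ of which have eigenvalues $\lambda_1,\dots,\lambda_d$; $E=[e_1,\dots,e_n]$. The flow map is $F^t(x_0)=x(t,x_0)$, assumed defined for the times used. Invariant manifold: $\mathcal{M}\subset\mathbb{R}^n$ is a $d$-dimensional invariant manifold of the flow containing $0$, with $T_0\mathcal{M}=\operatorname{span}\{e_1,\dots,e_d\}$. Observable: $\mu:\mathbb{R}^n\to\mathbb{R}$ differentiable. With modal coordinates $z=E^{-1}x\in\mathbb{C}^n$ and $\mu(x)=\mu(Ez)$, one has $\left.\frac{\partial\mu}{\partial z_k}\right|_{0}=D\mu(0)e_k$ ($D\mu(0)$ extended complex-linearly). $\mu$ is generic if $\left.\frac{\partial\mu}{\partial z_k}\right|_{0}\neq0$ for all $k\in\{1,\dots,d\}$. Delay embedding: the sampling map is $S:\mathbb{R}^n\to\mathbb{R}^p$, $S(x)=\big(\mu(x),\mu(F^{\tau}(x)),\dots,\mu(F^{(p-1)\tau}(x))\big)^{\top}$. The conditions of Takens's embedding theorem are assumed to hold, in the sense that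 $\Psi:=S|_{\mathcal{M}}:\mathcal{M}\to\tilde{\mathcal{M}}:=S(\mathcal{M})$ is a smooth (at least $C^1$) embedding with smooth inverse. The fixed point is $y_0=S(0)$. Delay-embedded system: the flow on $\tilde{\mathcal{M}}$ is $\Psi\circ F^t\circ\Psi^{-1}$, generated by the vector field $\tilde f(y)=D\Psi(x)(Ax+g(x))$ with $x=\Psi^{-1}(y)$; its linear part at $y_0$ is the linear map $D\tilde f(y_0)=D\Psi(0)\circ A|_{T_0\mathcal{M}}\circ(D\Psi(0))^{-1}$ on $T_{y_0}\tilde{\mathcal{M}}$. Convention: tangent spaces are complexified where complex eigenvectors occur. *)

(* Defs.v *)
From HB Require Import structures.
From mathcomp Require Import all_boot all_order all_algebra.
From mathcomp Require Import complex.
From mathcomp Require Import all_classical all_reals all_analysis.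

Set Implicit Arguments.
Unset Strict Implicit.
Unset Printing Implicit Defensive.

Import Order.TTheory GRing.Theory Num.Theory.
Import numFieldNormedType.Exports.

Local Open Scope classical_set_scope.
Local Open Scope complex_scope.
Local Open Scope ring_scope.

Section Regularity.
Context {R : realType}.

(* For k > 0 this is meant for open U.  In finite dimension, continuity of all
   the maps x |-> 'd f x v is continuity of the differential. *)
Fixpoint Ck_on {n m : nat} (k : nat) (U : set 'cV[R]_n)
    (f : 'cV[R]_n -> 'cV[R]_m) : Prop :=
  match k with
  | 0%N => forall x, U x -> {for x, continuous f}
  | k'.+1 => (forall x, U x -> differentiable f x) /\
             (forall v, Ck_on k' U (fun x => 'd f x v))
  end.

(* Term of total degree k of the power series in h with coefficients c, pushed
   forward by N: N = id gives the term itself, N = norm the sum of the norms of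
   its monomials. *)
Definition pseries_term {n m : nat} {W : zmodType} (N : 'cV[R]_m -> W)
    (c : {ffun 'I_n -> nat} -> 'cV[R]_m) (h : 'cV[R]_n) (k : nat) : W :=
  \sum_(a : {ffun 'I_n -> 'I_k.+1} | (\sum_i a i == k)%N)
     N ((\prod_i h i 0 ^+ a i) *: c [ffun i => nat_of_ord (a i)]).

Definition analytic {n m : nat} (f : 'cV[R]_n -> 'cV[R]_m) : Prop :=
  forall x0, exists (r : R) (c : {ffun 'I_n -> nat} -> 'cV[R]_m),
    0 < r /\ forall x, `|x - x0| < r ->
      cvgn (series (pseries_term (fun w => `|w|) c (x - x0))) /\
      series (pseries_term id c (x - x0)) @ \oo --> f x.

Inductive smoothness := Ck of nat | Cinfty | Canalytic.

Definition positive_class (l : smoothness) : Prop :=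
  if l is Ck k then (0 < k)%N else True.

Definition of_class {n m : nat} (l : smoothness)
    (f : 'cV[R]_n -> 'cV[R]_m) : Prop :=
  match l with
  | Ck k => Ck_on k setT f
  | Cinfty => forall k, Ck_on k setT f
  | Canalytic => analytic f
  end.

End Regularity.

Section Submanifolds.
Context {R : realType}.

(* C^1 maps on an arbitrary subset X of R^n: local restrictions of C^1 maps
   defined on open subsets of the ambient space. *)
Definition C1_map {n m : nat} (X : set 'cV[R]_n)
    (f : 'cV[R]_n -> 'cV[R]_m) : Prop :=
  forall x, X x -> exists (U : set 'cV[R]_n) (h : 'cV[R]_n -> 'cV[R]_m),
    [/\ open U, U x, Ck_on 1 U h & forall y, X y -> U y -> h y = f y].

Definition C1_diffeo {n m : nat} (X : set 'cV[R]_n) (Y : set 'cV[R]_m)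
    (f : 'cV[R]_n -> 'cV[R]_m) : Prop :=
  [/\ f @` X = Y, C1_map X f &
      exists2 f' : 'cV[R]_m -> 'cV[R]_n,
        forall x, X x -> f' (f x) = x & C1_map Y f'].

Definition is_submanifold {n : nat} (d : nat) (X : set 'cV[R]_n) : Prop :=
  forall x, X x -> exists (U : set 'cV[R]_n) (W : set 'cV[R]_d)
      (phi : 'cV[R]_d -> 'cV[R]_n),
    [/\ open U, U x, open W & C1_diffeo W (X `&` U) phi].

Definition tangent_space {n : nat} (X : set 'cV[R]_n) (x : 'cV[R]_n) :
    set 'cV[R]_n :=
  [set v | exists gamma : R -> 'cV[R]_n,
     [/\ gamma 0 = x, \forall t \near (0 : R), X (gamma t) &
         is_derive (0 : R) (1 : R) gamma v]].

Definition is_diff_along {n m : nat} (X : set 'cV[R]_n)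
    (f : 'cV[R]_n -> 'cV[R]_m) (x : 'cV[R]_n) (L : 'M[R]_(m, n)) : Prop :=
  (fun y => f y - f x - L *m (y - x)) =o_ (within X (nbhs x)) (fun y => y - x).

(* Differential of f : X -> R^m at x, as a matrix.  Only its action on
   [tangent_space X x] is determined by X and f: the matrix is a chosen linear
   extension to R^n (and junk if f is not differentiable along X at x). *)
Definition diff_along {n m : nat} (X : set 'cV[R]_n)
    (f : 'cV[R]_n -> 'cV[R]_m) (x : 'cV[R]_n) : 'M[R]_(m, n) :=
  get [set L | is_diff_along X f x L].

Definition complexification {n : nat} (T : set 'cV[R]_n) : set 'cV[R[i]]_n :=
  [set w | T (map_mx (@complex.Re R) w) /\ T (map_mx (@complex.Im R) w)].

End Submanifolds.

Section Configurations.
Context {R : realType}.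

Definition solution_on {n : nat} (f : 'cV[R]_n -> 'cV[R]_n) (a b : R)
    (x : R -> 'cV[R]_n) : Prop :=
  forall t : R, a < t < b -> is_derive t (1 : R) x (f (x t)).

Definition vfield {n : nat} (A : 'M[R]_n) (g : 'cV[R]_n -> 'cV[R]_n)
    (x : 'cV[R]_n) : 'cV[R]_n := A *m x + g x.

Definition sampling {n : nat} (p : nat) (tau : R) (F : R -> 'cV[R]_n -> 'cV[R]_n)
    (mu : 'cV[R]_n -> R) (x : 'cV[R]_n) : 'cV[R]_p :=
  \col_(j < p) mu (F (j%:R * tau) x).

(* [cfg_flowP] : F need only be the flow on, for each initial condition, an open
   time interval containing [0, (p-1) tau]; its other values are irrelevant.
   [cfg_invariant] : invariance in forward time, in which the delays are taken;
   it is implied by two-sided invariance. *)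
Record configuration (p d : nat) (tau : R) (lam : 'I_d -> R[i]) := Configuration {
  cfg_n : nat;
  cfg_A : 'M[R]_cfg_n;
  cfg_g : 'cV[R]_cfg_n -> 'cV[R]_cfg_n;
  cfg_l : smoothness;
  cfg_E : 'M[R[i]]_cfg_n;
  cfg_Lam : 'rV[R[i]]_cfg_n;
  cfg_F : R -> 'cV[R]_cfg_n -> 'cV[R]_cfg_n;
  cfg_M : set 'cV[R]_cfg_n;
  cfg_mu : 'cV[R]_cfg_n -> R;

  cfg_l_pos : positive_class cfg_l;
  cfg_class : of_class cfg_l (vfield cfg_A cfg_g);
  cfg_gO : cfg_g =O_ (0 : 'cV[R]_cfg_n) (fun x => `|x| ^+ 2);

  cfg_d_le : (d <= cfg_n)%N;
  cfg_E_unit : cfg_E \in unitmx;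
  cfg_diag : map_mx (real_complex R) cfg_A *m cfg_E = cfg_E *m diag_mx cfg_Lam;
  cfg_lam : forall k : 'I_d, cfg_Lam 0 (widen_ord cfg_d_le k) = lam k;

  cfg_flowP : forall x0, exists a b : R,
    [/\ a < 0, (p.-1)%:R * tau < b, cfg_F 0 x0 = x0 &
        solution_on (vfield cfg_A cfg_g) a b (cfg_F ^~ x0)];

  cfg_manifold : is_submanifold d cfg_M;
  cfg_M0 : cfg_M 0;
  cfg_invariant : forall (a b : R) (x : R -> 'cV[R]_cfg_n), a < 0 -> 0 < b ->
    solution_on (vfield cfg_A cfg_g) a b x -> cfg_M (x 0) ->
    forall t, 0 <= t < b -> cfg_M (x t);
  cfg_T0M : complexification (tangent_space cfg_M 0) =
    [set w | exists c : 'I_d -> R[i],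
       w = \sum_(k < d) c k *: col (widen_ord cfg_d_le k) cfg_E];

  cfg_mu_diff : forall x, differentiable cfg_mu x;

  cfg_embedding :
    C1_diffeo cfg_M (sampling p tau cfg_F cfg_mu @` cfg_M)
      (sampling p tau cfg_F cfg_mu)
}.

Arguments cfg_g {p d tau lam} c _.
Arguments cfg_F {p d tau lam} c _ _.
Arguments cfg_M {p d tau lam} c _.
Arguments cfg_mu {p d tau lam} c _.

Section Derived.
Context {p d : nat} {tau : R} {lam : 'I_d -> R[i]}.
Variable c : configuration p tau lam.

Definition cfg_e (k : 'I_d) : 'cV[R[i]]_(cfg_n c) :=
  col (widen_ord (cfg_d_le c) k) (cfg_E c).

(* D mu (0), extended complex-linearly, at w. *)
Definition cfg_Dmu0 (w : 'cV[R[i]]_(cfg_n c)) : R[i] :=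
  ('d (cfg_mu c) 0 (map_mx (@complex.Re R) w) : R) +i*
  ('d (cfg_mu c) 0 (map_mx (@complex.Im R) w) : R).

Definition generic : Prop := forall k : 'I_d, cfg_Dmu0 (cfg_e k) != 0.

Definition cfg_S : 'cV[R]_(cfg_n c) -> 'cV[R]_p :=
  sampling p tau (cfg_F c) (cfg_mu c).

Definition cfg_Mtilde : set 'cV[R]_p := cfg_S @` cfg_M c.

Definition cfg_y0 : 'cV[R]_p := cfg_S 0.

Definition cfg_ftilde (y : 'cV[R]_p) : 'cV[R]_p :=
  let x := pinv (cfg_M c) cfg_S y in
  diff_along (cfg_M c) cfg_S x *m vfield (cfg_A c) (cfg_g c) x.

Definition cfg_Dftilde : 'M[R]_p := diff_along cfg_Mtilde cfg_ftilde cfg_y0.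

End Derived.

Arguments cfg_S {p d tau lam} c _.
Arguments cfg_Mtilde {p d tau lam} c _.
Arguments cfg_ftilde {p d tau lam} c _.

End Configurations.

(* Main.v *)
Require Import Defs.
From mathcomp Require Import all_boot all_order all_algebra.
From mathcomp Require Import complex ring lra.
From mathcomp Require Import all_classical all_reals all_analysis.
Import Order.TTheory GRing.Theory Num.Theory.
Import numFieldNormedType.Exports.
Local Open Scope classical_set_scope.
Local Open Scope ring_scope.

(** Why the theorem holds.  Write [L] for the differential of the sampling map
    [S] at the fixed point, restricted to [T_0 M].  Everything rests on one
    computation, [sampling_eigenvector]: since [g] is quadratic, the time-[t]
    flow agrees to first order at 0 with the linear flow of [A], which
    multiplies an eigenvector [e_k] by [exp (lam_k t)].  Hence the [j]-th sample
    of [e_k] is [exp (lam_k j tau)] times the number [D mu (0) e_k], that is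
      [L e_k = (D mu (0) e_k) * (1, exp (lam_k tau), exp (2 lam_k tau), ...)].
    The vector on the right ([exp_samples]) depends on [tau] and [lam_k] only;
    the eigenvector and the observable enter through a scalar, which is nonzero
    by genericity.  So the complexified tangent space [L (T_0 M)] is the span of
    these vectors, and the delayed dynamics [L o A o L^-1] multiplies the
    [k]-th of them by [lam_k]: both are the same for the two configurations.

    Turning this into a proof takes three ingredients.

    The first-order behaviour of the flow at 0 ([flow_velocity]) follows from
    Gronwall's inequality alone ([perturbed_linear_growth]), used twice: a
    solution starting close to 0 stays comparable to its starting point, so that
    [g] is a forcing of second order along it, and then the difference between
    the solution and a solution of the linear system is bounded by the initial
    difference plus a term of second order.

    The map [S] is known to be [C^1] along [M] only, and its inverse is defined
    on the image only, so all differentials are taken along sets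
    ([diff_within]) and evaluated on velocities of curves staying in the set
    ([diff_within_velocity]).  This gives a chain rule, uniqueness on tangent
    vectors, and, from [Psi^-1 o Psi = id] and [Psi o Psi^-1 = id], the fact that
    [L] is a bijection from [T_0 M] to the tangent space of the image
    ([cfg_linearization]).

    The induced vector field is defined with a differential of [S] at every
    point of [M], and that differential is determined on tangent vectors only.
    As [M] is forward invariant, [A x + g x] is the velocity at [0+] of a curve
    in [M], hence the value [DS(x) (A x + g x)] does not depend on the choice
    ([diff_along_vfield]) and can be computed with a [C^1] extension of [S].
    Continuity of the differential of this extension and [g = O(|x|^2)] then
    give the derivative [L A] at 0 ([diff_within_vfield_image]). *)

(** * Sup-norm estimates for matrices *)

Section MatrixNorm.
Context {R : realType}.

Lemma ler_mx_entry {m n : nat} (B : 'M[R]_(m, n)) i j : `|B i j| <= `|B|.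
Proof.
rewrite [leRHS]/Num.Def.normr/= mx_normrE.
exact: (le_bigmax _ (fun ij : 'I_m * 'I_n => `|B ij.1 ij.2|) (i, j)).
Qed.

Lemma mx_norm_le {m n : nat} (B : 'M[R]_(m, n)) (e : R) :
  0 <= e -> (forall i j, `|B i j| <= e) -> `|B| <= e.
Proof.
move=> e0 Be; rewrite [leLHS]/Num.Def.normr/= mx_normrE.
by apply: bigmax_le => // ij _; exact: Be.
Qed.

Lemma mulmx_norm_le {m n : nat} (B : 'M[R]_(m, n)) (v : 'cV[R]_n) :
  `|B *m v| <= n%:R * `|B| * `|v|.
Proof.
apply: mx_norm_le => [|i j]; first by rewrite !mulr_ge0.
rewrite mxE (le_trans (ler_norm_sum _ _ _))//.
apply: (@le_trans _ _ (\sum_(k < n) `|B| * `|v|)).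
  by apply: ler_sum => k _; rewrite normrM ler_pM// ler_mx_entry.
by rewrite sumr_const card_ord -[leLHS]mulr_natl mulrA.
Qed.

Lemma mulmx_continuous {m n : nat} (B : 'M[R]_(m, n)) :
  continuous (mulmx B : 'cV[R]_n -> 'cV[R]_m).
Proof.
apply/linear_bounded_continuous/linear_boundedP; near=> r => x.
by rewrite (le_trans (mulmx_norm_le _ _))// ler_wpM2r.
Unshelve. all: by end_near. Qed.

End MatrixNorm.

(** * Differentials along arbitrary sets *)

Section Velocity.
Context {R : realType}.

(** Derivative of a curve along a filter of times: with [G = 0^'] the ordinary
    derivative at 0, with [G = 0^'+] the one-sided one that forward invariance
    provides. *)
Definition velocity {V : normedModType R} (G : set_system R) (gam : R -> V)
    (x v : V) : Prop :=
  (fun s : R => s^-1 *: (gam s - x)) @ G --> v.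

(** Epsilon form of [is_diff_along], for maps between arbitrary normed modules
    so that it also covers the real-valued observable. *)
Definition diff_within {V W : normedModType R} (X : set V) (f : V -> W) (x : V)
    (L : V -> W) : Prop :=
  forall e : R, 0 < e -> \forall y \near x, X y ->
    `|f y - f x - L (y - x)| <= e * `|y - x|.

Lemma is_diff_alongP {n m : nat} (X : set 'cV[R]_n) (f : 'cV[R]_n -> 'cV[R]_m)
    (x : 'cV[R]_n) (L : 'M[R]_(m, n)) :
  is_diff_along X f x L <-> diff_within X f x (mulmx L).
Proof.
split.
  by move=> /eqoP fo e /fo; rewrite near_withinE.
by move=> fo; apply/eqoP => e /fo; rewrite near_withinE.
Qed.

Lemma differentiable_within {V W : normedModType R} (X : set V) (f : V -> W)
    (x : V) : differentiable f x -> diff_within X f x ('d f x).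
Proof.
move=> [[_ fE]] e e0.
move/eqaddoP : fE => /(_ e e0); apply: filter_app.
by apply: nearW => y /= + _; rewrite !fctE /= lim_id// opprD addrA.
Qed.

Lemma near_dist_lt {V : normedModType R} (x : V) (e : R) : 0 < e ->
  \forall y \near x, `|y - x| < e.
Proof.
move=> e0; apply/nbhs_ballP; exists e => // y.
by rewrite -ball_normE /= distrC.
Qed.

Lemma diff_within_near {V W : normedModType R} (X : set V) (f g : V -> W)
    (x : V) (L : V -> W) :
  f x = g x -> (\forall y \near x, X y -> f y = g y) ->
  diff_within X f x L -> diff_within X g x L.
Proof.
move=> fgx fg fL e e0; apply: filterS2 fg (fL e e0) => y fgy + Xy.
by rewrite -fgx -fgy//; exact.
Qed.

Lemma diff_within_lipschitz {V W : normedModType R} (X : set V) (f : V -> W)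
    (x : V) (L : {linear V -> W}) : continuous L -> diff_within X f x L ->
  exists2 k : R, 0 < k &
    \forall y \near x, X y -> `|f y - f x| <= k * `|y - x|.
Proof.
move=> Lc fL.
have [k k0 Lk] : exists2 k : R, 0 < k & forall y, `|L y| <= k * `|y| :=
  linear_lipschitz Lc.
exists (k + 1); first by rewrite addr_gt0.
apply: filterS (fL 1 ltr01) => y fy Xy.
rewrite -(subrK (L (y - x)) (f y - f x)).
by rewrite (le_trans (ler_normD _ _))// addrC mulrDl lerD// fy.
Qed.

Lemma diff_within_comp {V W Z : normedModType R} (X : set V) (Y : set W)
    (f : V -> W) (g : W -> Z) (x : V) (L : {linear V -> W})
    (M : {linear W -> Z}) :
  (forall y, X y -> Y (f y)) -> continuous L -> continuous M ->
  diff_within X f x L -> diff_within Y g (f x) M ->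
  diff_within X (g \o f) x (M \o L).
Proof.
move=> XY Lc Mc fL gM e e0.
have [k k0 fk] := diff_within_lipschitz _ _ _ _ Lc fL.
have [l l0 Ml] : exists2 l : R, 0 < l & forall y, `|M y| <= l * `|y| :=
  linear_lipschitz Mc.
pose e1 := e / 2 / k; have e10 : 0 < e1 by rewrite !divr_gt0.
pose e2 := e / 2 / l; have e20 : 0 < e2 by rewrite !divr_gt0.
have [d /= d0 gd] := (@nbhs_ballP _ _ _ _).1 (gM _ e10).
have dk0 : 0 < d / k by rewrite divr_gt0.
apply: filterS3 fk (fL _ e20) (near_dist_lt x _ dk0) => y + + yd Xy /=.
move=> /(_ Xy) fyx /(_ Xy) fy.
have gy : `|g (f y) - g (f x) - M (f y - f x)| <= e1 * `|f y - f x|.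
  apply: gd; last exact: XY.
  by rewrite -ball_normE /= distrC (le_lt_trans fyx)// mulrC -ltr_pdivlMr.
rewrite -(subrK (M (f y - f x)) (g (f y) - g (f x))) -addrA -linearB.
rewrite (le_trans (ler_normD _ _))// (splitr e) mulrDl lerD//.
  have -> : e / 2 = e1 * k by rewrite /e1 divfK// gt_eqF.
  by rewrite (le_trans gy)// -mulrA ler_wpM2l// ltW.
have -> : e / 2 = l * e2 by rewrite [RHS]mulrC /e2 divfK// gt_eqF.
by rewrite (le_trans (Ml _))// -mulrA ler_wpM2l// ltW.
Qed.

Lemma velocity_cvg {V : normedModType R} (G : set_system R) {FG : Filter G}
    (gam : R -> V) (x v : V) :
  G `=>` 0^' -> velocity G gam x v -> gam @ G --> x.
Proof.
move=> G0 gv.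
have sG : (fun s : R => s) @ G --> (0 : R).
  by move=> A A0; apply: G0; exact: nbhs_dnbhs.
have := cvgD (cvgZ sG gv) (cvg_cst x : cst x @ G --> x).
rewrite scale0r add0r => sgv A /sgv.
have : \forall s \near G, s != 0 by apply: G0; exact: nearW.
apply: filterS2 => s s0.
by rewrite /= !fctE/= scalerA divff// scale1r subrK.
Qed.

Lemma velocity_unique {V : normedModType R} (G : set_system R)
    {FG : ProperFilter G} (gam : R -> V) (x v w : V) :
  velocity G gam x v -> velocity G gam x w -> v = w.
Proof. exact: norm_cvg_unique. Qed.

Lemma near_right_dnbhs : (0 : R)^'+ `=>` (0 : R)^'.
Proof.
move=> P /nbhs_ballP[r r0 rP]; apply/nbhs_ballP; exists r => // s rs s0.
by apply: rP => //; rewrite gt_eqF.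
Qed.

(** The bridge between differentials along a set and curves: it evaluates a
    differential on a vector from the values of [f] on one curve, and therefore
    shows at once that differentials along [X] push tangent vectors forward and
    are determined on them. *)
Lemma diff_within_velocity {V W : normedModType R} (G : set_system R)
    {FG : Filter G} (X : set V) (f : V -> W) (gam : R -> V) (x v : V)
    (L : {linear V -> W}) :
  G `=>` 0^' -> (\forall s \near G, X (gam s)) -> continuous L ->
  velocity G gam x v -> diff_within X f x L ->
  velocity G (f \o gam) (f x) (L v).
Proof.
move=> G0 XG Lc gv fL; have gx : gam @ G --> x by exact: velocity_cvg gv.
apply/cvgrPdist_le => /= e e0.
pose e1 := e / 2 / (`|v| + 1).
have e10 : 0 < e1 by rewrite !divr_gt0// ltr_wpDl.
have e20 : 0 < e / 2 by rewrite divr_gt0.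
have Lv : \forall s \near G, `|L v - L (s^-1 *: (gam s - x))| <= e / 2.
  exact: (cvgrPdist_le _ _).1 (cvg_comp _ _ gv (Lc v)) _ e20.
have s0G : \forall s \near G, s != 0 by apply: G0; exact: nearW.
(* the difference quotients of gam are bounded, so an error o(|gam s - x|) is
   o(s) *)
have gv1 : \forall s \near G, `|s^-1 *: (gam s - x)| <= `|v| + 1.
  apply: filterS ((cvgrPdist_le _ _).1 gv 1 ltr01) => s sv.
  rewrite -[X in `|X|](subrK v) (le_trans (ler_normD _ _))// addrC lerD2l.
  by rewrite distrC.
have fs : \forall s \near G,
    `|f (gam s) - f x - L (gam s - x)| <= e1 * `|gam s - x|.
  by apply: filterS2 XG (gx _ (fL _ e10)) => s XS; exact.
near=> s.
have s0 : s != 0 by near: s.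
have -> : L v - s^-1 *: ((f \o gam) s - f x) =
    (L v - L (s^-1 *: (gam s - x)))
    - s^-1 *: (f (gam s) - f x - L (gam s - x)).
  rewrite [L (_ *: _)]linearZ/=; move: (f (gam s) - f x) (L (gam s - x)) => D E.
  by rewrite (scalerBr _ D E) opprB addrA subrK.
rewrite (le_trans (ler_normB _ _))// (splitr e) lerD//; first by near: s.
have fss : `|f (gam s) - f x - L (gam s - x)| <= e1 * `|gam s - x|.
  by near: s.
rewrite normrZ (le_trans (ler_wpM2l (normr_ge0 _) fss))// mulrCA -normrZ.
have -> : e / 2 = e1 * (`|v| + 1) by rewrite /e1 divfK// gt_eqF// ltr_wpDl.
by rewrite ler_wpM2l// ?(ltW e10)//; near: s.
Unshelve. all: by end_near. Qed.

End Velocity.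

(** * Tangent vectors and differentials of C^1 maps *)

Section Tangent.
Context {R : realType}.

(** Counterpart of [lin1_mx] for column vectors. *)
Definition linmx {m n : nat} (L : 'cV[R]_n -> 'cV[R]_m) : 'M[R]_(m, n) :=
  \matrix_(i, j) L (delta_mx j 0) i 0.

Lemma linmxE {m n : nat} (L : {linear 'cV[R]_n -> 'cV[R]_m}) (v : 'cV[R]_n) :
  linmx L *m v = L v.
Proof.
rewrite {2}[v]matrix_sum_delta linear_sum; apply/colP => i.
rewrite mxE summxE; apply: eq_bigr => j _.
by rewrite big_ord1 linearZ/= !mxE mulrC.
Qed.

(** The differentials of a local extension [h] of [f] form a family of
    differentials along [X] that is continuous at [x], the finitely many
    columns of the matrix of ['d h y] being continuous in [y]. *)
Lemma C1_map_diff_within {n m : nat} (X : set 'cV[R]_n)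
    (f : 'cV[R]_n -> 'cV[R]_m) (x : 'cV[R]_n) :
  C1_map X f -> X x ->
  exists (U : set 'cV[R]_n) (D : 'cV[R]_n -> 'M[R]_(m, n)),
    [/\ nbhs x U,
        forall y, X y -> U y -> diff_within X f y (mulmx (D y)) &
        D @ x --> D x].
Proof.
move=> /[apply] -[U [h [oU Ux [dh ch] hf]]].
exists U, (fun y => linmx ('d h y)); split.
- exact: open_nbhs_nbhs.
- move=> y Xy Uy.
  have -> : mulmx (linmx ('d h y)) = 'd h y :> (_ -> _).
    by apply/funext => v; rewrite linmxE.
  apply: (@diff_within_near _ _ _ X h); first exact: hf.
    have : nbhs y U by exact: open_nbhs_nbhs.
    by apply: filterS => z Uz Xz; exact: hf.
  by apply: differentiable_within; exact: dh.
- apply/(@cvgrPdist_le _ _ _ (nbhs x)) => /= e e0.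
  have hD : \forall y \near x, forall j : 'I_n,
      `|'d h x (delta_mx j 0) - 'd h y (delta_mx j 0)| <= e.
    apply: (@filter_forall _ _ _ (nbhs x)) => j.
    exact: (cvgrPdist_le _ _).1 (ch (delta_mx j 0) x Ux) _ e0.
  near=> y; apply: mx_norm_le => [|i j]; first exact: ltW.
  have hy : forall j : 'I_n,
    `|'d h x (delta_mx j 0) - 'd h y (delta_mx j 0)| <= e by near: y.
  apply: le_trans (hy j); apply: le_trans (ler_mx_entry _ i 0).
  by rewrite !mxE.
Unshelve. all: by end_near.
Qed.

Lemma is_derive_velocity {V : normedModType R} (gam : R -> V) (v : V) :
  is_derive (0 : R) (1 : R) gam v <-> velocity 0^' gam (gam 0) v.
Proof.
have E : (fun h : R => h^-1 *: ((gam \o shift 0) (h *: 1) - gam 0)) =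
    (fun s : R => s^-1 *: (gam s - gam 0)).
  by apply/funext => s; rewrite /= addr0 [s *: 1]mulr1.
split=> [[dg <-]|gv].
  by move: dg; rewrite /derivable/derive/velocity E.
apply: DeriveDef; rewrite /derivable/derive E; last exact: cvg_lim.
by apply/cvg_ex; exists v.
Qed.

Lemma tangent_spaceP {n : nat} (X : set 'cV[R]_n) (x v : 'cV[R]_n) :
  tangent_space X x v <-> exists gamma : R -> 'cV[R]_n,
    [/\ gamma 0 = x, \forall t \near (0 : R), X (gamma t) &
        velocity 0^' gamma x v].
Proof.
split=> -[gam [g0 Xg gv]]; exists gam; split=> //.
  by rewrite -g0; exact/is_derive_velocity.
by apply/is_derive_velocity; rewrite g0.
Qed.

Lemma diff_within_tangent {n m : nat} (X : set 'cV[R]_n) (Y : set 'cV[R]_m)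
    (f : 'cV[R]_n -> 'cV[R]_m) (x v : 'cV[R]_n) (L : 'M[R]_(m, n)) :
  (forall y, X y -> Y (f y)) -> diff_within X f x (mulmx L) ->
  tangent_space X x v -> tangent_space Y (f x) (L *m v).
Proof.
move=> XY fL /tangent_spaceP[gam [g0 Xg gv]]; apply/tangent_spaceP.
exists (f \o gam); split; first by rewrite /= g0.
  by apply: filterS Xg => t /XY.
apply: (diff_within_velocity _ X) => //; last exact: mulmx_continuous.
exact: cvg_within Xg.
Qed.

Lemma diff_within_tangent_unique {n m : nat} (X : set 'cV[R]_n)
    (f : 'cV[R]_n -> 'cV[R]_m) (x v : 'cV[R]_n) (L M : 'M[R]_(m, n)) :
  diff_within X f x (mulmx L) -> diff_within X f x (mulmx M) ->
  tangent_space X x v -> L *m v = M *m v.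
Proof.
move=> fL fM /tangent_spaceP[gam [g0 Xg gv]].
have Xg' : \forall t \near 0^', X (gam t) by exact: cvg_within Xg.
apply: (@velocity_unique _ _ 0^' _ (f \o gam) (f x)).
  exact: (diff_within_velocity _ X _ _ _ _ (mulmx L) _ Xg'
    (mulmx_continuous L) gv fL).
exact: (diff_within_velocity _ X _ _ _ _ (mulmx M) _ Xg'
  (mulmx_continuous M) gv fM).
Qed.

Lemma diff_within_mulmx_comp {n m l : nat} (X : set 'cV[R]_n)
    (Y : set 'cV[R]_m) (f : 'cV[R]_n -> 'cV[R]_m) (g : 'cV[R]_m -> 'cV[R]_l)
    (x : 'cV[R]_n) (L : 'M[R]_(m, n)) (M : 'M[R]_(l, m)) :
  (forall y, X y -> Y (f y)) ->
  diff_within X f x (mulmx L) -> diff_within Y g (f x) (mulmx M) ->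
  diff_within X (g \o f) x (mulmx (M *m L)).
Proof.
move=> XY fL gM.
have -> : mulmx (M *m L) = mulmx M \o mulmx L :> ('cV[R]_n -> _).
  by apply/funext => v /=; rewrite mulmxA.
by apply: (diff_within_comp _ Y) => //; exact: mulmx_continuous.
Qed.

Lemma diff_within_id {n : nat} (X : set 'cV[R]_n) (f : 'cV[R]_n -> 'cV[R]_n)
    (x : 'cV[R]_n) :
  X x -> (forall y, X y -> f y = y) -> diff_within X f x (mulmx 1%:M).
Proof.
move=> Xx fE e e0; near=> y => Xy.
by rewrite !fE// mul1mx subrr normr0 mulr_ge0// ltW.
Unshelve. all: by end_near. Qed.

Lemma tangent_space0 {n : nat} (X : set 'cV[R]_n) (x : 'cV[R]_n) :
  X x -> tangent_space X x 0.
Proof.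
move=> Xx; exists (cst x); split; [by []|by near=> t; exact: Xx|exact: is_derive_cst].
Unshelve. all: by end_near. Qed.

End Tangent.

(** * A Gronwall estimate *)

Section Gronwall.
Context {R : realType}.

Lemma is_derive_entry {m n : nat} (y : R -> 'M[R]_(m, n)) (s : R)
    (v : 'M[R]_(m, n)) i j :
  is_derive s 1 y v -> is_derive s 1 (fun t => y t i j) (v i j).
Proof.
case=> dy <-; apply: DeriveDef; first exact: (derivable_mxP _ _ _).1.
by rewrite derive_mx// mxE.
Qed.

Lemma is_derive_entries {m n : nat} (y : R -> 'M[R]_(m, n)) (s : R)
    (v : 'M[R]_(m, n)) :
  (forall i j, is_derive s 1 (fun t => y t i j) (v i j)) -> is_derive s 1 y v.
Proof.
move=> yv; have dy : derivable y s 1 by apply/derivable_mxP => i j; case: (yv i j).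
apply: DeriveDef => //; rewrite derive_mx//; apply/matrixP => i j.
by rewrite mxE; case: (yv i j).
Qed.

Lemma nonpos_derive_le (P P' : R -> R) (t : R) : 0 <= t ->
  (forall s : R, 0 <= s <= t -> is_derive s 1 P (P' s)) ->
  (forall s : R, 0 < s < t -> P' s <= 0) -> P t <= P 0.
Proof.
move=> t0 dP P'0.
apply: (@ler0_derive1_nincr _ P 0 t _ _ _ 0 t); rewrite ?lexx//.
- move=> s /[!in_itv]/= /andP[/ltW s0 /ltW st].
  by have [] := dP s; rewrite ?s0.
- move=> s /[!in_itv]/= s0t; rewrite derive1E.
  have /andP[/ltW s0 /ltW st] := s0t.
  have dPs : is_derive s 1 P (P' s) by apply: dP; rewrite s0.
  by rewrite (@derive_val _ _ _ _ _ _ _ dPs) P'0.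
- apply: derivable_within_continuous => s /[!in_itv]/= st.
  by have [] := dP s.
Qed.

(** Gronwall's inequality for [V = |y|_2^2], a differentiable substitute for the
    squared sup norm: [V' <= C (V + eta^2)], so [exp (- C s) (V + eta^2)] is
    nonincreasing.  The perturbation may grow linearly with [y], for the use
    with the nonlinearity itself, or be small of size [eta], for the comparison
    with the linear flow.  The bound is only asked strictly inside the time
    interval, so that the estimate holds up to the first exit time from a
    ball. *)
Lemma perturbed_linear_growth {n : nat} (A : 'M[R]_n) (T : R) : 0 <= T ->
  exists2 K : R, 0 < K & forall (y w : R -> 'cV[R]_n) (t eta : R),
    0 <= t <= T -> 0 <= eta ->
    (forall s : R, 0 <= s <= t -> is_derive s 1 y (A *m y s + w s)) ->
    (forall s : R, 0 < s < t -> `|w s| <= `|y s| + eta) ->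
    `|y t| <= K * (`|y 0| + eta).
Proof.
move=> T0.
pose k : R := n%:R * `|A|; have k0 : 0 <= k by rewrite mulr_ge0.
pose C : R := 2 * n%:R * (k + 2); have C0 : 0 <= C by rewrite !mulr_ge0// addr_ge0.
pose K := expR (C * T) * (n%:R + 1).
have K1 : 1 <= K.
  by rewrite -[leLHS]mulr1 ler_pM// ?lerDr// -expR0 ler_expR mulr_ge0.
exists K => [|y w t eta /andP[t0 tT] eta0 yE wE]; first exact: lt_le_trans K1.
pose V : R -> R := \sum_(i < n) (fun s => y s i 0) ^+ 2.
pose V' s := \sum_(i < n) 2 * y s i 0 * (A *m y s + w s) i 0.
have VE s : V s = \sum_(i < n) y s i 0 ^+ 2.
  by rewrite /V fct_sumE; apply: eq_bigr => i _; rewrite exprfctE.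
have nV s : `|y s| ^+ 2 <= V s.
  have V0 : 0 <= V s by rewrite VE sumr_ge0// => i _; exact: sqr_ge0.
  rewrite -[leRHS]sqr_sqrtr// ler_sqr ?nnegrE ?sqrtr_ge0//.
  apply: mx_norm_le => [|i j]; first exact: sqrtr_ge0.
  rewrite ord1 -sqrtr_sqr ler_wsqrtr// VE (bigD1 i)//= lerDl.
  by apply: sumr_ge0 => l _; exact: sqr_ge0.
have sumc (c : R) : \sum_(i < n) c = n%:R * c.
  by rewrite sumr_const card_ord mulr_natl.
have Vn s : V s <= n%:R * `|y s| ^+ 2.
  rewrite VE -sumc; apply: ler_sum => i _; rewrite -real_normK ?num_real//.
  by rewrite ler_sqr ?nnegrE// ler_mx_entry.
have V'le (s : R) : 0 < s < t -> V' s <= C * (V s + eta ^+ 2).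
  move=> /wE ws.
  have Ayw : `|A *m y s + w s| <= (k + 1) * `|y s| + eta.
    rewrite (le_trans (ler_normD _ _))// mulrDl mul1r -addrA lerD//.
    exact: mulmx_norm_le.
  have V'n : V' s <= n%:R * (2 * `|y s| * ((k + 1) * `|y s| + eta)).
    rewrite /V' -sumc; apply: ler_sum => i _; rewrite (le_trans (ler_norm _))// normrM.
    rewrite ler_pM// ?(le_trans (ler_mx_entry _ _ _))//.
    by rewrite normrM ger0_norm// ler_wpM2l// ler_mx_entry.
  apply: (le_trans V'n).
  have -> : C * (V s + eta ^+ 2) = n%:R * (2 * (k + 2) * (V s + eta ^+ 2)).
    by rewrite /C; ring.
  rewrite ler_wpM2l//; have := nV s; have := sqr_ge0 (`|y s| - eta).
  have := mulr_ge0 k0 (sqr_ge0 eta); have := ler_wpM2l k0 (nV s).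
  have := sqr_ge0 eta; nra.
have dV (s : R) : 0 <= s <= t -> is_derive s 1 V (V' s).
  move=> /yE dy; apply: is_derive_eq.
    apply: is_derive_sum => i; apply: is_deriveX; exact: is_derive_entry dy.
  by apply: eq_bigr => i _; rewrite expr1.
pose P : R -> R := (expR \o ( *%R (- C))) * (V + cst (eta ^+ 2)).
have dP (s : R) : 0 <= s <= t ->
    is_derive s 1 P (expR (- C * s) * (V' s - C * (V s + eta ^+ 2))).
  move=> /dV dVs.
  have dE : is_derive s 1 (expR \o ( *%R (- C))) (expR (- C * s) * - C).
    apply: is_derive1_comp.
    have dl : is_derive s 1 (- C \*: (id : R -> R)) (- C *: (1 : R)).
      exact: is_deriveZ.
    by rewrite -[X in is_derive _ _ _ X]mulr1; exact: dl.
  have dW : is_derive s 1 (V + cst (eta ^+ 2)) (V' s + 0) by exact: is_deriveD.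
  apply: is_derive_eq (is_deriveM dE dW) _.
  rewrite addr0 -![_ *: _]/(_ * _) /= /cst.
  by rewrite addrfctE/=; ring.
have Pt : P t <= P 0.
  apply: nonpos_derive_le t0 dP _ => s s0t.
  by rewrite mulr_ge0_le0 ?expR_ge0// subr_le0 V'le.
have {}Pt : expR (- C * t) * (V t + eta ^+ 2) <= V 0 + eta ^+ 2.
  by move: Pt; rewrite /P /= !mulrfctE/= mulr0 expR0 mul1r.
have Vt : V t + eta ^+ 2 <= expR (C * T) * (V 0 + eta ^+ 2).
  rewrite -ler_pdivrMl ?expR_gt0// -expRN.
  apply: le_trans Pt; rewrite ler_wpM2r ?addr_ge0 ?sqr_ge0//.
    by rewrite (le_trans _ (nV t))// sqr_ge0.
  by rewrite ler_expR mulNr lerN2 ler_wpM2l.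
rewrite -ler_sqr ?nnegrE ?mulr_ge0 ?addr_ge0 ?(le_trans ler01 K1)//.
have a0 := normr_ge0 (y 0); have n0 : 0 <= n%:R :> R by [].
have Va : V 0 + eta ^+ 2 <= (n%:R + 1) * (`|y 0| + eta) ^+ 2.
  have ae := mulr_ge0 a0 eta0; have := Vn 0; have := mulr_ge0 n0 ae.
  have := mulr_ge0 n0 (sqr_ge0 eta); have := sqr_ge0 `|y 0|; nra.
apply: (@le_trans _ _ (K * (`|y 0| + eta) ^+ 2)).
  rewrite (le_trans (nV t))// (@le_trans _ _ (V t + eta ^+ 2)) ?lerDl ?sqr_ge0//.
  by rewrite (le_trans Vt)// /K -mulrA ler_wpM2l// expR_ge0.
by rewrite exprMn ler_wpM2r ?sqr_ge0// expr2 ler_peMl// (le_trans ler01 K1).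
Qed.

End Gronwall.

(** * The flow near the fixed point *)

Section NearEquilibrium.
Context {R : realType} {n : nat}.
Variables (A : 'M[R]_n) (g : 'cV[R]_n -> 'cV[R]_n).
Hypothesis gO : g =O_ (0 : 'cV[R]_n) (fun x => `|x| ^+ 2).

Lemma quadratic_remainder : exists k rho : R, [/\ 0 < k, 0 < rho &
  forall x, `|x| < rho -> `|g x| <= k * `|x| ^+ 2].
Proof.
have [k k0 /nbhs_ballP[rho /= rho0 gk]] := (eqO_exP _ _ _).1 gO.
exists k, rho; split=> // x xrho.
have := gk x; rewrite -ball_normE /= sub0r normrN => /(_ xrho).
by rewrite [`| `|x| ^+ 2 |]ger0_norm// exprn_ge0.
Qed.

(** Where [|g x| <= |x|], the Gronwall estimate bounds [x t] by [K |x 0|].  A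
    solution starting close enough to 0 never leaves that region: at the first
    exit time the estimate would still apply and contradict the exit. *)
Lemma solution_near_equilibrium (T : R) : 0 <= T ->
  exists r K : R, [/\ 0 < r, 0 < K & forall x : R -> 'cV[R]_n,
    (forall s : R, 0 <= s <= T -> is_derive s 1 x (vfield A g (x s))) ->
    `|x 0| < r -> forall t : R, 0 <= t <= T ->
    `|x t| <= K * `|x 0| /\ `|g (x t)| <= K * `|x 0| ^+ 2].
Proof.
move=> T0; have [k [rho [k0 rho0 gk]]] := quadratic_remainder.
have [K K0 grow] := perturbed_linear_growth A T T0.
(* in the ball of radius e both |g x| <= k |x|^2 and k |x| <= 1 hold *)
pose e := Num.min rho k^-1.
have e0 : 0 < e by rewrite lt_min rho0 invr_gt0.
have ge x : `|x| < e -> `|g x| <= `|x|.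
  rewrite lt_min => /andP[xrho xk]; rewrite (le_trans (gk _ xrho))//.
  by rewrite expr2 mulrA ler_piMl// mulrC -ler_pdivlMr// div1r ltW.
pose K' := K + k * K ^+ 2.
have KK' : K <= K' by rewrite lerDl mulr_ge0 ?sqr_ge0// ltW.
exists (e / K), K'; split.
- by rewrite divr_gt0.
- exact: lt_le_trans KK'.
move=> x xE x0r.
have x0e : K * `|x 0| < e by rewrite mulrC -ltr_pdivlMr.
have step t : 0 <= t <= T -> (forall s, 0 < s < t -> `|x s| < e) ->
    `|x t| <= K * `|x 0|.
  move=> /andP[t0 tT] small; rewrite -[`|x 0|]addr0.
  apply: (grow x (g \o x)) => //; first by rewrite t0.
    by move=> s /andP[s0 st]; apply: xE; rewrite s0 (le_trans st).
  by move=> s /small/ge; rewrite addr0.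
(* otherwise the infimum of the set B of times spent outside the ball is a first
   exit time *)
have xe t : 0 <= t <= T -> `|x t| < e.
  move=> /andP[t0 tT]; rewrite ltNge; apply/negP => xt.
  pose B := [set s : R | 0 <= s <= T /\ e <= `|x s|].
  have Bt : B t by rewrite /B/= t0 tT.
  have B0 : has_inf B.
    split; first by exists t.
    by exists 0 => s [/andP[]].
  have inf0 : 0 <= inf B by apply: (lb_le_inf B0.1) => s [/andP[]].
  have infT : inf B <= T.
    by rewrite (le_trans _ tT)//; apply: (ge_inf B0.2).
  have infB : `|x (inf B)| < e.
    apply: le_lt_trans x0e; apply: step; first by rewrite inf0.
    move=> s /andP[s0 sB]; rewrite ltNge; apply/negP => es.
    have : inf B <= s.
      by apply: (ge_inf B0.2); rewrite /B/= (ltW s0) (le_trans (ltW sB) infT).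
    by rewrite leNgt sB.
  have xc : {for inf B, continuous x}.
    apply: differentiable_continuous; apply/derivable1_diffP.
    by have [] := xE (inf B); rewrite ?inf0.
  have /nbhs_ballP[d /= d0 xd] : \forall s \near inf B, `|x s| < e.
    have xnc : (fun s => `|x s|) @ inf B --> `|x (inf B)| by exact: cvg_norm.
    exact: (cvgr_lt _ xnc).
  have [s Bs sd] := inf_adherent d0 B0.
  have : `|x s| < e.
    apply: xd; rewrite -ball_normE /= distrC ger0_norm ?ltrBlDl//.
    by rewrite subr_ge0; apply: (ge_inf B0.2).
  by rewrite ltNge Bs.2.
move=> t tT.
have xt : `|x t| <= K * `|x 0|.
  apply: step => // s /andP[s0 st]; apply: xe; rewrite (ltW s0).
  by case/andP: tT => _; apply: le_trans; exact: ltW.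
split; first by rewrite (le_trans xt)// ler_wpM2r.
have xrho : `|x t| < rho by have := xe t tT; rewrite lt_min => /andP[].
rewrite (le_trans (gk _ xrho))// (@le_trans _ _ (k * (K * `|x 0|) ^+ 2))//.
  by rewrite ler_wpM2l ?(ltW k0)// ler_sqr ?nnegrE// mulr_ge0// ltW.
by rewrite exprMn mulrA ler_wpM2r ?sqr_ge0// lerDr ltW.
Qed.

(** The derivative of the time-[T] map at 0 is the linear flow, tested on a
    curve of initial conditions: [q] is the linear evolution of the velocity of
    that curve. *)
Lemma flow_velocity (F : R -> 'cV[R]_n -> 'cV[R]_n) (T : R)
    (gam : R -> 'cV[R]_n) (q : R -> 'cV[R]_n) : 0 <= T ->
  (forall x, F 0 x = x /\
    forall s : R, 0 <= s <= T -> is_derive s 1 (F ^~ x) (vfield A g (F s x))) ->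
  (forall s : R, is_derive s 1 q (A *m q s)) ->
  velocity 0^' gam 0 (q 0) -> velocity 0^' (fun s => F T (gam s)) 0 (q T).
Proof.
move=> T0 FE qE gv.
have [r [K [r0 K0 near0]]] := solution_near_equilibrium T T0.
have [K' K'0 grow] := perturbed_linear_growth A T T0.
have gam0 : gam @ 0^' --> (0 : 'cV[R]_n) by exact: velocity_cvg gv.
apply/cvgrPdist_le => /= e e0.
(* t |-> F^t(gam s) - s q(t) solves the linear equation up to a forcing O(s^2),
   and it starts at gam s - s q(0) = o(s) *)
have main : \forall s \near 0^', `|F T (gam s) - s *: q T| <=
    K' * (`|gam s - s *: q 0| + K * `|gam s| ^+ 2).
  have : \forall s \near 0^', `|gam s| < r.
    have gn : (fun s => `|gam s|) @ 0^' --> `|0 : 'cV[R]_n| by exact: cvg_norm.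
    by apply: (cvgr_lt _ gn); rewrite normr0.
  apply: filterS => s gr; have [F0 FD] := FE (gam s).
  have /= := grow (fun t => F t (gam s) - s *: q t) (fun t => g (F t (gam s))) T
    (K * `|gam s| ^+ 2).
  rewrite F0; apply.
  - by rewrite T0 lexx.
  - by rewrite mulr_ge0// ?exprn_ge0// ltW.
  - move=> t tT.
    apply: is_derive_eq (is_deriveB (FD t tT) (is_deriveZ s (qE t))) _.
    by rewrite /vfield mulmxBr -scalemxAr addrAC.
  - move=> t /andP[/ltW t0 /ltW tT].
    have [||_ gt] := near0 (F ^~ (gam s)) FD _ t; rewrite ?F0 ?t0//.
    by rewrite F0 in gt; rewrite (le_trans gt)// lerDr.
pose M := `|q 0| + 1; have M0 : 0 < M by rewrite ltr_wpDl.
have gE s : s^-1 *: (gam s - 0) = s^-1 *: gam s by rewrite subr0.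
pose e1 := e / 2 / K'; have e10 : 0 < e1 by rewrite !divr_gt0.
pose e2 := e1 / (K * M); have e20 : 0 < e2 by rewrite divr_gt0// mulr_gt0.
have gv1 := (cvgrPdist_le _ _).1 gv e1 e10.
have gv2 := (cvgrPdist_le _ _).1 gv 1 ltr01.
have gam2 := (cvgrPdist_le _ _).1 gam0 e2 e20.
near=> s.
have s0 : s != 0 by near: s; exact: nbhs_dnbhs_neq.
have mains : `|F T (gam s) - s *: q T| <=
    K' * (`|gam s - s *: q 0| + K * `|gam s| ^+ 2) by near: s.
have gs1 : `|q 0 - s^-1 *: gam s| <= e1.
  by rewrite -gE; near: s; exact: gv1.
have gsM : `|s^-1 *: gam s| <= M.
  rewrite -[X in `|X|](subrK (q 0)) (le_trans (ler_normD _ _))// addrC lerD2l.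
  by rewrite distrC -gE; near: s; exact: gv2.
have gs2 : `|gam s| <= e2.
  by rewrite -[gam s]opprK normrN -[- gam s]add0r; near: s; exact: gam2.
have sn0 : 0 < `|s| by rewrite normr_gt0.
have -> : q T - s^-1 *: (F T (gam s) - 0) = s^-1 *: (s *: q T - F T (gam s)).
  by rewrite subr0 scalerBr scalerA mulVf// scale1r.
have -> : e = K' * (e1 + e1) by rewrite /e1; field; rewrite gt_eqF.
rewrite normrZ normfV ler_pdivrMl// distrC (le_trans mains)//.
rewrite [leRHS]mulrCA ler_wpM2l ?(ltW K'0)// mulrDr lerD//.
  have -> : gam s - s *: q 0 = - (s *: (q 0 - s^-1 *: gam s)).
    by rewrite scalerBr scalerA divff// scale1r opprB.
  by rewrite normrN normrZ ler_wpM2l.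
have gsM' : `|gam s| <= `|s| * M.
  by rewrite -ler_pdivrMl// -normfV -normrZ.
have -> : `|s| * e1 = K * (`|s| * M * e2).
  by rewrite /e2; field; rewrite !gt_eqF.
by rewrite ler_wpM2l ?(ltW K0)// expr2 ler_pM.
Unshelve. all: by end_near. Qed.

End NearEquilibrium.

(** * Explicit solutions of the linear system *)

Section Oscillator.
Context {R : realType} {n : nat}.

(** Real part of [exp ((a + i b) t) (u + i v)]. *)
Definition spiral (a b : R) (u v : 'cV[R]_n) (t : R) : 'cV[R]_n :=
  (expR (a * t) * cos (b * t)) *: u - (expR (a * t) * sin (b * t)) *: v.

Lemma spiral0 (a b : R) (u v : 'cV[R]_n) : spiral a b u v 0 = u.
Proof.
by rewrite /spiral !mulr0 expR0 cos0 sin0 mulr1 mulr0 scale1r scale0r subr0.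
Qed.

(** The two hypotheses are the real and imaginary parts of the eigenvector
    equation [A (u + i v) = (a + i b) (u + i v)]. *)
Lemma is_derive_spiral (A : 'M[R]_n) (a b : R) (u v : 'cV[R]_n) (t : R) :
  A *m u = a *: u - b *: v -> A *m v = b *: u + a *: v ->
  is_derive t 1 (spiral a b u v) (A *m spiral a b u v t).
Proof.
move=> Au Av; apply: is_derive_entries => i j; rewrite ord1 {j}.
have dl (k : R) : is_derive t 1 (k \*: (id : R -> R)) (k *: (1 : R)).
  exact: is_deriveZ.
have dE := is_derive1_comp (is_derive_expR (a * t)) (dl a).
have dC := is_derive1_comp (is_derive_cos (b * t)) (dl b).
have dS := is_derive1_comp (is_derive_sin (b * t)) (dl b).
have dcos := is_deriveZ (u i 0) (is_deriveM dE dC).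
have dsin := is_deriveZ (v i 0) (is_deriveM dE dS).
have -> : (fun s => spiral a b u v s i 0) =
   u i 0 \*: ((expR \o (a \*: (id : R -> R))) * (cos \o (b \*: (id : R -> R)))) -
   v i 0 \*: ((expR \o (a \*: (id : R -> R))) * (sin \o (b \*: (id : R -> R)))).
  by apply/funext => s; rewrite !mxE mulrC [X in _ - X]mulrC.
apply: is_derive_eq (is_deriveB dcos dsin) _.
rewrite mulmxBr -!scalemxAr Au Av !mxE -![_ *: _]/(_ * _) /=.
ring.
Qed.

End Oscillator.

(** * First-order part of the transported vector field *)

Section LinearPart.
Context {R : realType} {n : nat}.

(** With [f x = A x + g x], the increment is
    [D x (f x) - D 0 (A x) = D x (g x) - (D 0 - D x) (A x)], where the first
    term is of second order and the second one is [o(1) * O(|x|)]. *)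
Lemma diff_within_vfield_image {m : nat} (X : set 'cV[R]_n) (A : 'M[R]_n)
    (g : 'cV[R]_n -> 'cV[R]_n) (D : 'cV[R]_n -> 'M[R]_(m, n)) :
  g =O_ (0 : 'cV[R]_n) (fun x => `|x| ^+ 2) -> D @ (0 : 'cV[R]_n) --> D 0 ->
  diff_within X (fun x => D x *m vfield A g x) 0 (mulmx (D 0 *m A)).
Proof.
move=> gO Dc e e0; have [k [rho [k0 rho0 gk]]] := quadratic_remainder g gO.
have g0 : g 0 = 0.
  apply/eqP; rewrite -normr_le0.
  by have := gk 0; rewrite normr0 expr0n mulr0; exact.
(* the constants are increased by 1 so that one can divide by them *)
pose N : R := n%:R + 1; have N0 : 0 < N by rewrite ltr_wpDl.
pose a := `|A| + 1; have a0 : 0 < a by rewrite ltr_wpDl.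
pose d := `|D 0| + 1; have d0 : 0 < d by rewrite ltr_wpDl.
have mulN (l : nat) (B : 'M[R]_(l, n)) (v : 'cV[R]_n) :
    `|B *m v| <= N * `|B| * `|v|.
  by rewrite (le_trans (mulmx_norm_le _ _))// !ler_wpM2r// lerDl.
pose e1 := e / 2 / (N * (N * a)).
have e10 : 0 < e1 by rewrite !divr_gt0// !mulr_gt0.
pose e2 := e / 2 / (N * d * k).
have e20 : 0 < e2 by rewrite !divr_gt0// !mulr_gt0.
have e1E : e / 2 = N * e1 * (N * a) by rewrite /e1; field; rewrite !gt_eqF.
have e2E : e / 2 = N * d * k * e2 by rewrite /e2; field; rewrite !gt_eqF.
clearbody e1 e2.
have D1 := (@cvgrPdist_le _ _ _ (nbhs (0 : 'cV[R]_n)) _ _ _).1 Dc e1 e10.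
have D2 := (@cvgrPdist_le _ _ _ (nbhs (0 : 'cV[R]_n)) _ _ _).1 Dc 1 ltr01.
have D3 := near_dist_lt (0 : 'cV[R]_n) _ rho0.
have D4 := near_dist_lt (0 : 'cV[R]_n) _ e20.
near=> x => _.
have Dx1 : `|D 0 - D x| <= e1 by near: x; exact: D1.
have Dx2 : `|D x| <= d.
  rewrite -[X in `|X|](subrK (D 0)) (le_trans (ler_normD _ _))// addrC lerD2l.
  by rewrite distrC; near: x; exact: D2.
have xrho : `|x| < rho by rewrite -[x]subr0; near: x; exact: D3.
have xe2 : `|x| <= e2.
  by rewrite ltW// -[x]subr0; near: x; exact: D4.
have -> : D x *m vfield A g x - D 0 *m vfield A g 0 - D 0 *m A *m (x - 0) =
    D x *m g x - (D 0 - D x) *m (A *m x).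
  rewrite /vfield g0 mulmx0 addr0 mulmx0 !subr0 mulmxDr mulmxBl !mulmxA opprB.
  by rewrite [RHS]addrCA addrA.
rewrite subr0 (le_trans (ler_normB _ _))// (splitr e) mulrDl lerD//.
  rewrite (le_trans (mulN _ _ _))// (@le_trans _ _ (N * d * (k * `|x| ^+ 2)))//.
    by rewrite ler_pM ?mulr_ge0 ?ler_wpM2l ?(ltW N0)// gk.
  rewrite e2E.
  by rewrite expr2 !mulrA ler_wpM2r// ler_wpM2l// ltW// !mulr_gt0.
rewrite e1E.
rewrite (le_trans (mulN _ _ _))// -[leRHS]mulrA.
rewrite ler_pM ?mulr_ge0 ?(ltW N0)//; first by rewrite ler_wpM2l ?(ltW N0).
by rewrite (le_trans (mulN _ _ _))// ler_wpM2r// ler_wpM2l ?(ltW N0)// lerDl.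
Unshelve. all: by end_near. Qed.

End LinearPart.

(** * Real and imaginary parts of complex vectors *)

Section RealComplex.
Context {R : realType}.

Local Notation RC := (real_complex R).
Local Notation mxRe := (map_mx (@complex.Re R)).
Local Notation mxIm := (map_mx (@complex.Im R)).

Lemma cmxP {m n : nat} (w w' : 'M[R[i]]_(m, n)) :
  mxRe w = mxRe w' -> mxIm w = mxIm w' -> w = w'.
Proof.
move=> /matrixP re /matrixP im; apply/matrixP => i j.
move: (re i j) (im i j); rewrite !mxE.
by case: (w i j) (w' i j) => ? ? [? ?] /= -> ->.
Qed.

Lemma Re_mulmx {m n l : nat} (L : 'M[R]_(m, n)) (w : 'M[R[i]]_(n, l)) :
  mxRe (map_mx RC L *m w) = L *m mxRe w.
Proof.
apply/matrixP => i j; rewrite !mxE raddf_sum; apply: eq_bigr => k _.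
by rewrite !mxE; case: (w k j) => a b /=; rewrite mul0r subr0.
Qed.

Lemma Im_mulmx {m n l : nat} (L : 'M[R]_(m, n)) (w : 'M[R[i]]_(n, l)) :
  mxIm (map_mx RC L *m w) = L *m mxIm w.
Proof.
apply/matrixP => i j; rewrite !mxE raddf_sum; apply: eq_bigr => k _.
by rewrite !mxE; case: (w k j) => a b /=; rewrite mul0r addr0.
Qed.

Lemma Re_map {m n : nat} (w : 'M[R]_(m, n)) : mxRe (map_mx RC w) = w.
Proof. by apply/matrixP => i j; rewrite !mxE. Qed.

Lemma Im_map {m n : nat} (w : 'M[R]_(m, n)) : mxIm (map_mx RC w) = 0.
Proof. by apply/matrixP => i j; rewrite !mxE. Qed.

End RealComplex.

(** * Delay embedding of one configuration *)

Section Config.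
Context {R : realType} {p d : nat} {tau : R} {lam : 'I_d -> R[i]}.
Variable c : configuration p tau lam.
Hypothesis tau0 : 0 < tau.

Local Notation RC := (real_complex R).
Local Notation A := (cfg_A c).
Local Notation n := (cfg_n c).
Local Notation g := (@cfg_g _ _ _ _ _ c).
Local Notation M := (@cfg_M _ _ _ _ _ c).
Local Notation S := (@cfg_S _ _ _ _ _ c).
Local Notation F := (@cfg_F _ _ _ _ _ c).
Local Notation mu := (@cfg_mu _ _ _ _ _ c).

Lemma cfg_flow (T : R) : 0 <= T <= p.-1%:R * tau -> forall x, F 0 x = x /\
    forall s : R, 0 <= s <= T -> is_derive s 1 (F ^~ x) (vfield A g (F s x)).
Proof.
move=> /andP[T0 Tp] x; have [a [b [a0 pb F0 sol]]] := cfg_flowP x.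
split=> // s /andP[s0 sT]; apply: sol.
by rewrite (lt_le_trans a0)// (le_lt_trans sT)// (le_lt_trans Tp).
Qed.

Lemma cfg_flow_origin (T : R) : 0 <= T <= p.-1%:R * tau -> F T 0 = 0.
Proof.
move=> T0p; have /andP[T0 _] := T0p; have [F0 FD] := cfg_flow T T0p 0.
have [r [K [r0 K0 H]]] := solution_near_equilibrium A g (cfg_gO c) T T0.
have := H (F ^~ 0) FD; rewrite F0 normr0 => /(_ r0 T) [].
  by rewrite T0 lexx.
by rewrite mulr0 normr_le0 => /eqP.
Qed.

Lemma delay_range (j : 'I_p) : 0 <= j%:R * tau <= p.-1%:R * tau.
Proof.
rewrite mulr_ge0 ?(ltW tau0)//= ler_wpM2r ?(ltW tau0)// ler_nat.
by case: j => j /=; case: p.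
Qed.

(** The [j]-th sample along a curve in [M] with velocity [u] is [mu] along its
    image under the flow, whose velocity is the linear evolution of [u]. *)
Lemma sampling_velocity (a b : R) (u v : 'cV[R]_n) (L : 'M[R]_(p, n)) (j : 'I_p) :
  A *m u = a *: u - b *: v -> A *m v = b *: u + a *: v ->
  diff_within M S 0 (mulmx L) -> tangent_space M 0 u ->
  (L *m u) j 0 = 'd mu 0 (spiral a b u v (j%:R * tau)) :> R.
Proof.
move=> Au Av SL /tangent_spaceP[gam [g0 Mg gv]].
pose T := j%:R * tau; have T0p : 0 <= T <= p.-1%:R * tau by exact: delay_range.
have /andP[T0 _] := T0p.
have Mg' : \forall t \near 0^', M (gam t) by exact: cvg_within Mg.
have SV : velocity 0^' (S \o gam) (S 0) (L *m u).
  apply: (diff_within_velocity _ M _ _ _ _ (mulmx L)) => //.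
  exact: mulmx_continuous.
have SjV : velocity 0^' (fun s => S (gam s) j 0) (S 0 j 0) ((L *m u) j 0).
  have := cvg_comp _ _ SV (@coord_continuous _ _ _ j 0 (L *m u)).
  by apply: cvg_trans; apply: near_eq_cvg; near=> s; rewrite /= !mxE.
have FV : velocity 0^' (fun s => F T (gam s)) 0 (spiral a b u v T).
  apply: (flow_velocity A g (cfg_gO c)) => //.
  - exact: cfg_flow.
  - by move=> s; exact: is_derive_spiral.
  - by rewrite spiral0.
have muV : velocity 0^' (mu \o (fun s => F T (gam s))) (mu 0)
    ('d mu 0 (spiral a b u v T)).
  apply: (diff_within_velocity _ setT) => //.
  - by near=> s.
  - by apply: diff_continuous; exact: cfg_mu_diff.
  - by apply: differentiable_within; exact: cfg_mu_diff.
apply: velocity_unique SjV _.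
rewrite mxE cfg_flow_origin//.
apply: cvg_trans muV; apply: near_eq_cvg; near=> s; rewrite mxE//.
Unshelve. all: by end_near. Qed.

(** Samples at the times [0, tau, 2 tau, ...] of the function
    [t |-> exp (l t)]. *)
Definition exp_samples (l : R[i]) : 'cV[R[i]]_p :=
  \col_j ((expR (complex.Re l * (j%:R * tau)))%:C%C *
          (cos (complex.Im l * (j%:R * tau)) +i*
           sin (complex.Im l * (j%:R * tau)))%C).

Local Notation e := (cfg_e c).

Lemma cfg_eigen (k : 'I_d) : map_mx RC A *m e k = lam k *: e k.
Proof.
rewrite /cfg_e -(cfg_lam c k); apply/colP => i.
have /matrixP/(_ i (widen_ord (cfg_d_le c) k)) := cfg_diag c.
rewrite mul_mx_diag !mxE mulrC => <-.
by apply: eq_bigr => j _; rewrite !mxE.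
Qed.

(** The eigenvalue equation in the real form required by [spiral]. *)
Lemma cfg_eigen_re (k : 'I_d) :
  let a := complex.Re (lam k) in let b := complex.Im (lam k) in
  let u := map_mx (@complex.Re R) (e k) in
  let v := map_mx (@complex.Im R) (e k) in
  A *m u = a *: u - b *: v /\ A *m v = b *: u + a *: v.
Proof.
rewrite /= -Re_mulmx -Im_mulmx cfg_eigen; split; apply/matrixP => i j.
  by rewrite !mxE; case: (lam k) => a b /=; case: (cfg_E c _ _).
rewrite !mxE; case: (lam k) => a b /=; case: (cfg_E c _ _) => x y /=.
by rewrite addrC.
Qed.

Lemma cfg_e_tangent (k : 'I_d) :
  tangent_space M 0 (map_mx (@complex.Re R) (e k)) /\
  tangent_space M 0 (map_mx (@complex.Im R) (e k)).
Proof.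
have : complexification (tangent_space M 0) (e k).
  rewrite cfg_T0M; exists (fun l => (l == k)%:R).
  rewrite (bigD1 k)//= eqxx scale1r big1 ?addr0// => l /negbTE ->.
  by rewrite scale0r.
by [].
Qed.

(** The real part comes from the pair [(Re e_k, Im e_k)]; the imaginary part from
    [(Im e_k, - Re e_k)], the real and imaginary parts of the eigenvector
    [- i e_k]. *)
Lemma sampling_eigenvector (L : 'M[R]_(p, n)) (k : 'I_d) :
  diff_within M S 0 (mulmx L) ->
  map_mx RC L *m e k = cfg_Dmu0 (e k) *: exp_samples (lam k).
Proof.
move=> SL; have [Au Av] := cfg_eigen_re k; have [Tu Tv] := cfg_e_tangent k.
rewrite /cfg_Dmu0; set u := map_mx _ (e k) in Au Av Tu *.
set v := map_mx _ (e k) in Au Av Tv *.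
set a := complex.Re _ in Au Av; set b := complex.Im _ in Au Av.
have Av' : A *m v = a *: v - b *: - u by rewrite Av scalerN opprK addrC.
have Au' : A *m - u = b *: v + a *: - u.
  by rewrite mulmxN Au scalerN opprB.
have lin (x y : R) (w z : 'cV[R]_n) : ('d mu 0 (x *: w - y *: z) : R) =
    x * 'd mu 0 w - y * 'd mu 0 z by rewrite linearB !linearZ.
apply: cmxP; rewrite ?Re_mulmx ?Im_mulmx; apply/matrixP => j z; rewrite ord1 {z}.
  rewrite (sampling_velocity _ _ _ _ _ _ Au Av SL Tu) /spiral lin !mxE /=.
  rewrite -/a -/b; ring.
rewrite (sampling_velocity _ _ _ _ _ _ Av' Au' SL Tv) /spiral lin linearN !mxE /=.
rewrite -/a -/b; ring.
Qed.

(** [diff_along] is a chosen extension of a differential that is unique only on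
    tangent vectors.  The trajectory of [x] stays in [M] for positive times, so
    the vector field is a one-sided velocity inside [M] and all choices agree on
    it. *)
Lemma diff_along_vfield (x : 'cV[R]_n) (L : 'M[R]_(p, n)) : M x ->
  diff_within M S x (mulmx L) ->
  diff_along M S x *m vfield A g x = L *m vfield A g x.
Proof.
move=> Mx SL.
have SD : diff_within M S x (mulmx (diff_along M S x)).
  apply/is_diff_alongP; rewrite /diff_along.
  by apply: (@getPex _ [set L | is_diff_along M S x L]); exists L; apply/is_diff_alongP.
have [a [b [a0 pb F0 sol]]] := cfg_flowP x.
have b0 : 0 < b by rewrite (le_lt_trans _ pb)// mulr_ge0// ltW.
have Mr : \forall t \near 0^'+, M (F t x).
  near=> t.
  have t0 : 0 < t by near: t; exact: nbhs_right_gt.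
  have tb : t < b by near: t; exact: nbhs_right_lt.
  by apply: (cfg_invariant a0 b0 sol); rewrite ?F0// (ltW t0).
have FV : velocity 0^'+ (F ^~ x) x (vfield A g x).
  have /is_derive_velocity FV0 : is_derive (0 : R) (1 : R) (F ^~ x) (vfield A g x).
    by rewrite -[in vfield A g x]F0; apply: sol; rewrite a0.
  by rewrite F0 in FV0; move=> P /FV0; exact: near_right_dnbhs.
apply: (@velocity_unique _ _ 0^'+ _ (S \o F ^~ x) (S x)).
  apply: (diff_within_velocity _ M _ _ _ _ (mulmx (diff_along M S x))) => //.
    exact: near_right_dnbhs.
  exact: mulmx_continuous.
apply: (diff_within_velocity _ M _ _ _ _ (mulmx L)) => //.
  exact: near_right_dnbhs.
exact: mulmx_continuous.
Unshelve. all: by end_near. Qed.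

(** [L] and [L'] are differentials of the embedding and of its inverse.  They are
    mutually inverse only between the two tangent spaces, because the
    compositions of the maps are the identity only on [M] and on its image. *)
Lemma cfg_linearization :
  exists (L : 'M[R]_(p, n)) (L' : 'M[R]_(n, p)),
    [/\ diff_within M S 0 (mulmx L),
        forall w, tangent_space (cfg_Mtilde c) (cfg_y0 c) w <->
          exists2 u, tangent_space M 0 u & w = L *m u,
        forall u, tangent_space M 0 u -> L' *m (L *m u) = u &
        diff_within (cfg_Mtilde c) (cfg_ftilde c) (cfg_y0 c)
          (mulmx (L *m A *m L'))].
Proof.
have [_ SC1 [S' S'K S'C1]] := cfg_embedding c.
have M0 := cfg_M0 c.
have [U [D [U0 DS Dc]]] := C1_map_diff_within M S 0 SC1 M0.
have MtS x : M x -> cfg_Mtilde c (S x) by move=> Mx; exists x.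
have [U' [D' [U'0 D'S _]]] := C1_map_diff_within _ S' _ S'C1 (MtS _ M0).
have S'M y : cfg_Mtilde c y -> M (S' y) by move=> [x Mx <-]; rewrite S'K.
have S'y0 : S' (cfg_y0 c) = 0 by exact: S'K.
have DS0 := DS 0 M0 (nbhs_singleton U0).
have DS'0 := D'S _ (MtS _ M0) (nbhs_singleton U'0).
set L := D 0 in DS0 *; set L' := D' _ in DS'0.
have L'L u : tangent_space M 0 u -> L' *m (L *m u) = u.
  move=> Tu; rewrite mulmxA -[RHS]mul1mx.
  apply: (diff_within_tangent_unique M (S' \o S) 0) Tu.
    exact: diff_within_mulmx_comp DS0 DS'0.
  exact: diff_within_id.
have LL' w : tangent_space (cfg_Mtilde c) (cfg_y0 c) w -> L *m (L' *m w) = w.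
  move=> Tw; rewrite mulmxA -[RHS]mul1mx.
  apply: (diff_within_tangent_unique (cfg_Mtilde c) (S \o S') (cfg_y0 c)) Tw.
    by apply: (diff_within_mulmx_comp _ M) DS'0 _ => //; rewrite S'y0.
  by apply: diff_within_id; [exact: MtS|move=> y [x Mx <-] /=; rewrite S'K].
exists L, L'; split=> //.
- move=> w; split=> [Tw|[u Tu ->]]; last first.
    exact: diff_within_tangent MtS DS0 Tu.
  exists (L' *m w); last by rewrite LL'.
  by rewrite -S'y0; exact: diff_within_tangent S'M DS'0 Tw.
have ftS x : M x -> U x -> cfg_ftilde c (S x) = D x *m vfield A g x.
  move=> Mx Ux; rewrite /cfg_ftilde pinvKV ?inE//; last first.
    move=> y z; rewrite !inE => My Mz Syz.
    by rewrite -[y]S'K// -[z]S'K//; congr S'.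
  by apply: diff_along_vfield => //; exact: DS.
(* the inverse S' sends points close to y0 into U, where D is available *)
have near_ft : \forall y \near cfg_y0 c, cfg_Mtilde c y ->
    D (S' y) *m vfield A g (S' y) = cfg_ftilde c y.
  have [k k0 S'k] := diff_within_lipschitz _ _ _ _ (mulmx_continuous L') DS'0.
  have /nbhs_ballP[r /= r0 rU] := U0.
  have rk : 0 < r / k by rewrite divr_gt0.
  apply: filterS2 S'k (near_dist_lt (cfg_y0 c) _ rk) => y + yr Mty.
  move=> /(_ Mty); rewrite S'y0 subr0 => S'yk.
  have S'yU : U (S' y).
    apply: rU; rewrite -ball_normE /= sub0r normrN (le_lt_trans S'yk)//.
    by rewrite mulrC -ltr_pdivlMr.
  have [x Mx Sx] := Mty; move: S'yU; rewrite -Sx S'K// => Ux.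
  by rewrite ftS.
apply: (diff_within_near _ _ _ _ _ _ near_ft).
  exact: (nbhs_singleton near_ft) (MtS _ M0).
apply: (diff_within_mulmx_comp _ M S' (fun x => D x *m vfield A g x)) => //.
rewrite S'y0; apply: diff_within_vfield_image => //; exact: cfg_gO.
Qed.

(** Both pieces of data are expressed through [exp_samples] only: in the first
    claim the coefficients [a k] absorb the factors [D mu (0) e_k], which are
    invertible by genericity; in the third these factors cancel. *)
Lemma cfg_delay_image : generic c ->
  [/\ forall w, tangent_space (cfg_Mtilde c) (cfg_y0 c) w <->
        exists a : 'I_d -> R[i],
          map_mx RC w = \sum_(k < d) a k *: exp_samples (lam k),
      is_diff_along (cfg_Mtilde c) (cfg_ftilde c) (cfg_y0 c) (cfg_Dftilde c) &
      forall k, map_mx RC (cfg_Dftilde c) *m exp_samples (lam k) =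
        lam k *: exp_samples (lam k)].
Proof.
move=> gen; have [L [L' [SL TP L'L ftL]]] := cfg_linearization.
have Le k : map_mx RC L *m e k = cfg_Dmu0 (e k) *: exp_samples (lam k).
  exact: sampling_eigenvector.
have ftD : is_diff_along (cfg_Mtilde c) (cfg_ftilde c) (cfg_y0 c) (cfg_Dftilde c).
  apply: (@getPex _ [set N | is_diff_along (cfg_Mtilde c) (cfg_ftilde c)
    (cfg_y0 c) N]).
  by exists (L *m A *m L'); apply/is_diff_alongP.
have DL u : tangent_space M 0 u -> cfg_Dftilde c *m (L *m u) = L *m (A *m u).
  move=> Tu; have TLu : tangent_space (cfg_Mtilde c) (cfg_y0 c) (L *m u).
    by apply/TP; exists u.
  move/is_diff_alongP : ftD => ftD.
  rewrite (diff_within_tangent_unique _ _ _ _ _ _ ftD ftL TLu).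
  by rewrite -!mulmxA L'L.
split=> //.
- have /seteqP[Tsub spanT] := cfg_T0M c.
  move=> w; rewrite TP; split=> [[u Tu ->]|[a wE]].
    have [|a uE] := Tsub (map_mx RC u).
      split; rewrite ?Re_map// Im_map; apply: tangent_space0; exact: cfg_M0.
    exists (fun k => a k * cfg_Dmu0 (e k)).
    rewrite map_mxM uE mulmx_sumr; apply: eq_bigr => k _.
    by rewrite -scalemxAr Le scalerA.
  pose z := \sum_(k < d) (a k / cfg_Dmu0 (e k)) *: e k.
  have [Tz _] : complexification (tangent_space M 0) z.
    by apply: spanT; exists (fun k => a k / cfg_Dmu0 (e k)).
  exists (map_mx (@complex.Re R) z) => //; rewrite -Re_mulmx -[LHS]Re_map wE.
  congr map_mx; rewrite mulmx_sumr; apply: eq_bigr => k _.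
  by rewrite -scalemxAr Le scalerA divfK//; exact: gen.
- move=> k; have [Tu Tv] := cfg_e_tangent k.
  apply: (scalerI (gen k)).
  rewrite scalerA [_ * lam k]mulrC -scalerA -Le scalemxAr -Le.
  transitivity (map_mx RC L *m (map_mx RC A *m e k)); last first.
    by rewrite cfg_eigen -scalemxAr.
  by apply: cmxP; rewrite !(Re_mulmx, Im_mulmx) DL.
Qed.

End Config.

Theorem corollary1 (R : realType) (p d : nat) (tau : R) (lam : 'I_d -> R[i])
    (hp : (0 < p)%N) (hd : (0 < d)%N) (htau : 0 < tau) (hlam : injective lam)
    (c1 c2 : configuration p tau lam) (hgen1 : generic c1) (hgen2 : generic c2) :
  [/\ tangent_space (cfg_Mtilde c1) (cfg_y0 c1) =
        tangent_space (cfg_Mtilde c2) (cfg_y0 c2),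
      is_diff_along (cfg_Mtilde c1) (cfg_ftilde c1) (cfg_y0 c1) (cfg_Dftilde c1),
      is_diff_along (cfg_Mtilde c2) (cfg_ftilde c2) (cfg_y0 c2) (cfg_Dftilde c2) &
      forall w, tangent_space (cfg_Mtilde c1) (cfg_y0 c1) w ->
        cfg_Dftilde c1 *m w = cfg_Dftilde c2 *m w].
Proof.
have [T1 D1 E1] := cfg_delay_image c1 htau hgen1.
have [T2 D2 E2] := cfg_delay_image c2 htau hgen2.
split=> //.
  by apply/seteqP; split=> w; [move=> /T1/T2 | move=> /T2/T1].
move=> w /T1[a wE]; rewrite -[LHS]Re_map -[RHS]Re_map; congr map_mx.
rewrite !map_mxM wE !mulmx_sumr; apply: eq_bigr => k _.
by rewrite -!scalemxAr E1 E2.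
Qed.
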